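(* Let $p>1$, let $\Gamma$ be a simple graph with $N$ vertices having no null vertex (no vertex of degree $0$), and let $F=\{f_i\}_{i=1}^N$ be a $\Gamma(N,n)$-frame for $\mathbb{C}^n$. If $F$ is a tight frame, then $(F,S_F^{-1}F)$ is a $1$-erasure optimal dual pair both under the spectral radius and under the operator norm, i.e. $(F,S_F^{-1}F)\in\mathcal{E}_1^p$ and $(F,S_F^{-1}F)\in\mathcal{O}_1^p$.
   Context: A sequence $F=\{f_i\}_{i=1}^N$ in an $n$-dimensional Hilbert space $\mathcal{H}$ is a frame if there are $A,B>0$ with $A\|f\|^2\le\sum_{i=1}^N|\langle f,f_i\rangle|^2\le B\|f\|^2$ for all $f\in\mathcal{H}$; it is tight if one can take $A=B$. Its analysis operator is $\Theta_F f=(\langle f,f_i\rangle)_{i=1}^N$, with adjoint $\Theta_F^*(c_i)_i=\sum_i c_if_i$; the frame operator is $S_F=\Theta_F^*\Theta_F$ (positive and invertible) and the Gramian matrix is the matrix of $\mathcal{G}=\Theta_F\Theta_F^*$, with $(i,j)$ entry $\langle f_j,f_i\rangle$. A frame $G=\{g_i\}_{i=1}^N$ is a dual of $F$ if $f=\sum_{i=1}^N\langle f,f_i\rangle g_i$ for all $f$; then $(F,G)$ is an $(N,n)$ dual pair. The canonical dual is $S_F^{-1}F=\{S_F^{-1}f_i\}_{i=1}^N$. Let $\mathcal{D}^{(1)}$ be the set of $N\times N$ diagonal matrices with exactly one diagonal entry equal to $1$ and all others $0$; $\rho$ is the spectral radius and $\|\cdot\|$ the operator norm. Define $$\mathcal{E}_1^p(F,G)=\Big\{\frac1N\sum_{D\in\mathcal{D}^{(1)}}\big(\rho(\Theta_G^*D\Theta_F)\big)^p\Big\}^{1/p},\qquad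 \mathcal{O}_1^p(F,G)=\Big\{\frac1N\sum_{D\in\mathcal{D}^{(1)}}\|\Theta_G^*D\Theta_F\|^p\Big\}^{1/p},$$ let $\delta_1^p$, $\Delta_1^p$ be the infima of $\mathcal{E}_1^p(F,G)$, $\mathcal{O}_1^p(F,G)$ respectively over all $(N,n)$ dual pairs $(F,G)$, and let $\mathcal{E}_1^p$, $\mathcal{O}_1^p$ be the sets of $(N,n)$ dual pairs with $\mathcal{E}_1^p(F,G)=\delta_1^p$, respectively $\mathcal{O}_1^p(F,G)=\Delta_1^p$. (Superscript $p$ is an index, not a power.) The Laplacian of a simple graph $\Gamma$ on $N$ vertices is $\mathcal{L}(\Gamma)=\mathcal{D}(\Gamma)-\mathcal{A}(\Gamma)$, with $\mathcal{D}(\Gamma)$ the diagonal degree matrix and $\mathcal{A}(\Gamma)$ the adjacency matrix. A frame $F=\{f_i\}_{i=1}^N$ for an $n$-dimensional space is a $\Gamma(N,n)$-frame if its Gramian matrix equals $\mathcal{L}(\Gamma)$. *)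

(* Defs.v *)
From HB Require Import structures.
From mathcomp Require Import all_boot all_order all_algebra.
From mathcomp Require Import complex.
From mathcomp Require Import all_classical all_reals all_analysis.

Set Implicit Arguments.
Unset Strict Implicit.
Unset Printing Implicit Defensive.

Import Order.TTheory GRing.Theory Num.Theory.
Local Open Scope classical_set_scope.
Local Open Scope sesquilinear_scope.
Local Open Scope ring_scope.

(* C^n is 'cV[R[i]]_n for R : realType; a sequence of N vectors is a function
   'I_N -> 'cV[R[i]]_n.  Moduli, norms and bounds are R-valued. *)

Section HilbertSpace.
Variables (R : realType) (n : nat).

(* linear in the first argument *)
Definition inner (x y : 'cV[R[i]]_n) : R[i] := \sum_k x k 0 * (y k 0)^*.

Definition l2norm (x : 'cV[R[i]]_n) : R :=
  Num.sqrt (\sum_k Normc.normc (x k 0) ^+ 2).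

(* [eigenvalue] is phrased with row eigenvectors, but a matrix and its transpose
   have the same eigenvalues. *)
Definition spectral_radius (A : 'M[R[i]]_n) : R :=
  sup [set Normc.normc a | a in [set a | eigenvalue A a]].

Definition operator_norm (A : 'M[R[i]]_n) : R :=
  sup [set l2norm (A *m x) | x in [set x | l2norm x <= 1]].

End HilbertSpace.

Section Frames.
Variables (R : realType) (N n : nat).
Implicit Types F G : 'I_N -> 'cV[R[i]]_n.

Definition frame_bounds F (A B : R) : Prop :=
  [/\ 0 < A, 0 < B & forall f : 'cV[R[i]]_n,
    A * l2norm f ^+ 2 <= \sum_i Normc.normc (inner f (F i)) ^+ 2
                      <= B * l2norm f ^+ 2].

Definition is_frame F : Prop := exists A B, frame_bounds F A B.

Definition is_tight_frame F : Prop := exists A, frame_bounds F A A.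

(* the matrix of f |-> (<f, f_i>)_i; see [analysisE] *)
Definition analysis F : 'M[R[i]]_(N, n) := \matrix_(i, k) (F i k 0)^*.

Definition frame_op F : 'M[R[i]]_n := (analysis F)^t* *m analysis F.

Definition gramian F : 'M[R[i]]_N := analysis F *m (analysis F)^t*.

Definition canonical_dual F : 'I_N -> 'cV[R[i]]_n :=
  fun i => invmx (frame_op F) *m F i.

Definition is_dual_pair F G : Prop :=
  [/\ is_frame F, is_frame G &
      forall f : 'cV[R[i]]_n, f = \sum_i inner f (F i) *: G i].

Lemma analysisE F f : analysis F *m f = \col_i inner f (F i).
Proof.
by apply/colP=> i; rewrite !mxE; apply: eq_bigr => k _; rewrite !mxE mulrC.
Qed.

Lemma analysis_adjE F c : (analysis F)^t* *m c = \sum_i c i 0 *: F i.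
Proof.
apply/colP=> k; rewrite !mxE summxE; apply: eq_bigr => i _.
by rewrite !mxE conjCK mulrC.
Qed.

Lemma gramianE F i j : gramian F i j = inner (F j) (F i).
Proof.
by rewrite !mxE; apply: eq_bigr => k _; rewrite !mxE conjCK mulrC.
Qed.

End Frames.

Section Erasures.
Variables (R : realType) (N n : nat).
Implicit Types F G : 'I_N -> 'cV[R[i]]_n.

Definition D1 : set 'M[R[i]]_N :=
  [set D | is_diag_mx D /\
     exists i, D i i = 1 /\ forall j, j != i -> D j j = 0].

Lemma D1E : D1 = [set delta_mx i i | i in [set: 'I_N]].
Proof.
apply/seteqP; split=> [D [/is_diag_mxP dD [i [Dii Djj]]]|_ [i _ <-]].
  exists i => //; apply/matrixP=> j k; rewrite mxE.
  have [<-|neq_jk] := eqVneq j k.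
    by have [->|/Djj->//] := eqVneq j i; rewrite ?Dii.
  rewrite dD//; case: eqP => //= eq_ji; case: eqP => //= eq_ki.
  by rewrite eq_ji eq_ki eqxx in neq_jk.
split.
  apply/is_diag_mxP=> j k neq_jk; rewrite mxE.
  case: eqP => //= eq_ji; case: eqP => //= eq_ki.
  by rewrite eq_ji eq_ki eqxx in neq_jk.
exists i; split=> [|j /negPf neq_ji]; first by rewrite mxE eqxx.
by rewrite mxE neq_ji.
Qed.

Lemma sum_D1 (phi : 'M[R[i]]_N -> R) :
  \sum_(D \in D1) phi D = \sum_(i < N) phi (delta_mx i i).
Proof.
rewrite D1E fsbig_image => [|i j _ _ /matrixP/(_ i i)/eqP]; last first.
  rewrite !mxE eqxx/=.
  by have [//|_] := eqVneq i j; rewrite oner_eq0.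
rewrite [RHS]fsbig_seq ?index_enum_uniq//; apply: eq_fsbigl.
by apply/seteqP; split=> i _ //=; rewrite mem_index_enum.
Qed.

Definition erasure_op F G (D : 'M[R[i]]_N) : 'M[R[i]]_n :=
  (analysis G)^t* *m D *m analysis F.

Definition E1 (p : R) F G : R :=
  (N%:R^-1 * \sum_(D \in D1) spectral_radius (erasure_op F G D) `^ p) `^ p^-1.

Definition O1 (p : R) F G : R :=
  (N%:R^-1 * \sum_(D \in D1) operator_norm (erasure_op F G D) `^ p) `^ p^-1.

Definition dual_pairs : set (('I_N -> 'cV[R[i]]_n) * ('I_N -> 'cV[R[i]]_n)) :=
  [set FG | is_dual_pair FG.1 FG.2].

Definition delta1 (p : R) : R := inf [set E1 p FG.1 FG.2 | FG in dual_pairs].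

Definition Delta1 (p : R) : R := inf [set O1 p FG.1 FG.2 | FG in dual_pairs].

Definition E1_optimal (p : R) :
    set (('I_N -> 'cV[R[i]]_n) * ('I_N -> 'cV[R[i]]_n)) :=
  [set FG | dual_pairs FG /\ E1 p FG.1 FG.2 = delta1 p].

Definition O1_optimal (p : R) :
    set (('I_N -> 'cV[R[i]]_n) * ('I_N -> 'cV[R[i]]_n)) :=
  [set FG | dual_pairs FG /\ O1 p FG.1 FG.2 = Delta1 p].

End Erasures.

Section Graphs.
Variable N : nat.

(* a simple graph on the vertex set 'I_N *)
Definition is_simple_graph (e : rel 'I_N) : Prop := symmetric e /\ irreflexive e.

Definition degree (e : rel 'I_N) (v : 'I_N) : nat := #|[pred w | e v w]|.

Definition no_null_vertex (e : rel 'I_N) : Prop := forall v, degree e v <> 0%N.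

Definition degree_mx (K : pzRingType) (e : rel 'I_N) : 'M[K]_N :=
  diag_mx (\row_v (degree e v)%:R).

Definition adjacency_mx (K : pzRingType) (e : rel 'I_N) : 'M[K]_N :=
  \matrix_(v, w) (e v w)%:R.

Definition laplacian (K : pzRingType) (e : rel 'I_N) : 'M[K]_N :=
  degree_mx K e - adjacency_mx K e.

Definition is_graph_frame (R : realType) (n : nat) (e : rel 'I_N)
    (F : 'I_N -> 'cV[R[i]]_n) : Prop :=
  is_frame F /\ gramian F = laplacian R[i] e.

End Graphs.

(* Main.v *)
Require Import Defs.
From mathcomp Require Import all_boot all_order all_algebra.
From mathcomp Require Import complex.
From mathcomp Require Import all_classical all_reals all_analysis.

(** Erasing the [i]-th coefficient of a dual pair (F, G) leaves the error
    operator [x |-> <x, f_i> g_i], of rank one, whose spectral radius is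
    [|<g_i, f_i>|] and whose operator norm is [||g_i|| ||f_i||].  The former is
    at most the latter by Cauchy-Schwarz.  Reconstruction says that these
    operators add up to the identity, so taking traces gives
    [\sum_i <g_i, f_i> = n].  As the p-th power mean dominates the arithmetic
    mean, both error functionals are at least [n / N] on every dual pair
    ([E1_ge], [O1_ge]), and they attain this value as soon as
    [|<g_i, f_i>| = ||g_i|| ||f_i|| = n / N] for all [i]
    ([uniform_dual_pair_optimal]).

    It remains to see that the canonical dual of a tight Laplacian frame is
    uniform in this sense.  If the frame bound is [A], the frame operator is [A]
    times the identity (polarization), so that [g_i = A^-1 f_i], and the
    Gramian, which is the Laplacian [L], satisfies [L^2 = A L].  On the diagonal
    this reads [d_i^2 + d_i = A d_i], where [d_i != 0] is the degree of [i],
    hence [||f_i||^2 = d_i = A - 1] ([tight_graph_sqnorm]).  So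
    [<g_i, f_i> = ||g_i|| ||f_i||] does not depend on [i], and the trace
    identity forces its value to be [n / N]. *)

Import Order.TTheory GRing.Theory Num.Theory.
Local Open Scope classical_set_scope.
Local Open Scope sesquilinear_scope.
Local Open Scope complex_scope.
Local Open Scope ring_scope.

(** * Extrema and matrix extensionality *)

Lemma sup_max {R : realType} {E : set R} {x : R} :
  E x -> ubound E x -> sup E = x.
Proof.
move=> Ex ubx; apply/eqP; rewrite eq_le ge_sup//; last by exists x.
by rewrite ub_le_sup//; exists x.
Qed.

Lemma inf_min {R : realType} {T : Type} {S : set T} {phi : T -> R} {x : T} :
  S x -> (forall y, S y -> phi x <= phi y) -> phi x = inf [set phi y | y in S].
Proof.
move=> Sx phix; apply/eqP; rewrite eq_le lb_le_inf/=; last first.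
- by move=> _ [y Sy <-]; exact: phix.
- by exists (phi x); exists x.
by apply: ge_inf; [exists (phi x) => _ [y Sy <-]; exact: phix|exists x].
Qed.

Lemma mulmx_col_inj {K : pzRingType} {m n} (A B : 'M[K]_(m, n)) :
  (forall x : 'cV_n, A *m x = B *m x) -> A = B.
Proof.
move=> AB; apply/matrixP=> i j.
by have /colP/(_ i) := AB (delta_mx j 0); rewrite -!colE !mxE.
Qed.

(** * Inner product and rank-one operators *)

Section Inner.
Context {R : realType} {n : nat}.
Implicit Types x y z f g : 'cV[R[i]]_n.

Lemma normc_normE (z : R[i]) : (Normc.normc z)%:C = `|z|.
Proof. by rewrite normc_def; case: z. Qed.

Lemma normc_ge0 (z : R[i]) : 0 <= Normc.normc z.
Proof. by rewrite -lecR normc_normE normr_ge0. Qed.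

Lemma normc_real (a : R) : Normc.normc a%:C = `|a|.
Proof. by rewrite /Normc.normc/= expr0n/= addr0 sqrtr_sqr. Qed.

Lemma normc_conj (z : R[i]) : Normc.normc (Num.conj z) = Normc.normc z.
Proof. by apply: complexI; rewrite !normc_normE norm_conjC. Qed.

Lemma innerE x y : inner x y = (y^t* *m x) 0 0.
Proof. by rewrite !mxE; apply: eq_bigr => k _; rewrite !mxE mulrC. Qed.

Lemma inner_dotmx x y : inner x y = dotmx x^T y^T.
Proof.
by rewrite dotmxE trmxK !mxE; apply: eq_bigr => k _; rewrite !mxE.
Qed.

Lemma innerZl (a : R[i]) x y : inner (a *: x) y = a * inner x y.
Proof.
by rewrite /inner mulr_sumr; apply: eq_bigr => k _; rewrite mxE mulrA.
Qed.

Lemma innerDl x y z : inner (x + y) z = inner x z + inner y z.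
Proof.
by rewrite /inner -big_split; apply: eq_bigr => k _; rewrite mxE mulrDl.
Qed.

Lemma innerC x y : inner x y = (inner y x)^*.
Proof.
rewrite /inner rmorph_sum; apply: eq_bigr => k _.
by rewrite rmorphM/= conjCK mulrC.
Qed.

Lemma innerDr x y z : inner x (y + z) = inner x y + inner x z.
Proof. by rewrite innerC innerDl rmorphD/= -!innerC. Qed.

Lemma innerZr (a : R[i]) x y : inner x (a *: y) = a^* * inner x y.
Proof. by rewrite innerC innerZl rmorphM/= -innerC. Qed.

Lemma l2norm_ge0 x : 0 <= l2norm x.
Proof. exact: sqrtr_ge0. Qed.

Lemma sqr_l2norm x : (l2norm x ^+ 2)%:C = inner x x.
Proof.
rewrite /l2norm sqr_sqrtr ?sumr_ge0// => [|k _]; last exact: sqr_ge0.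
rewrite rmorph_sum; apply: eq_bigr => k _.
by rewrite rmorphXn/= normc_normE normCK.
Qed.

Lemma l2normZ (a : R[i]) x : l2norm (a *: x) = Normc.normc a * l2norm x.
Proof.
rewrite /l2norm -[X in X * _]ger0_norm ?normc_ge0// -sqrtr_sqr.
rewrite -sqrtrM ?sqr_ge0//.
congr Num.sqrt; rewrite mulr_sumr; apply: eq_bigr => k _.
by rewrite mxE Normc.normcM exprMn.
Qed.

Lemma l2norm_eq0 x : (l2norm x == 0) = (x == 0).
Proof.
rewrite -(sqrf_eq0 (l2norm x)) -(inj_eq (@complexI R)) sqr_l2norm inner_dotmx.
by rewrite dnorm_eq0 trmx_eq0.
Qed.

Lemma l2norm0 : l2norm (0 : 'cV[R[i]]_n) = 0.
Proof. by apply/eqP; rewrite l2norm_eq0. Qed.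

Lemma inner_CauchySchwarz x y : Normc.normc (inner x y) <= l2norm x * l2norm y.
Proof.
rewrite -(@ler_pXn2r _ 2)// ?nnegrE ?mulr_ge0 ?l2norm_ge0 ?normc_ge0//.
rewrite exprMn -lecR rmorphXn/= normc_normE rmorphM/= !sqr_l2norm.
by rewrite !inner_dotmx CauchySchwarz.
Qed.

Lemma spectral_radius_rank1 g f :
  spectral_radius (g *m f^t*) = Normc.normc (inner g f).
Proof.
(* A left eigenvector [v] for [a] satisfies [a (v g) = (v g) <g, f>]. *)
have eig a : eigenvalue (g *m f^t*) a -> a = 0 \/ a = inner g f.
  case/eigenvalueP=> v vA vn0.
  have [vg0|vgn0] := eqVneq (v *m g) 0.
    left; move/eqP: vA; rewrite mulmxA vg0 mul0mx eq_sym scaler_eq0 (negPf vn0).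
    by rewrite orbF => /eqP.
  right; apply/eqP; rewrite -subr_eq0 -[_ == 0]orbF -(negPf vgn0).
  rewrite -scaler_eq0 scalerBl subr_eq0 scalemxAl -vA.
  by rewrite -!mulmxA [f^t* *m g]mx11_scalar !mul_mx_scalar innerE scalemxAr.
rewrite /spectral_radius; set E := [set _ | _ in _].
(* If [<g, f> = 0] the set of moduli is [{0}], or empty in dimension [0]. *)
have [c0|cn0] := eqVneq (inner g f) 0.
  have /subset_set1[] : E `<=` [set 0].
    by move=> _ [a /eig[->|->] <-]; rewrite ?c0 Normc.normc0.
  - by move=> ->; rewrite sup0 c0 Normc.normc0.
  - by move=> ->; rewrite sup1 c0 Normc.normc0.
apply: sup_max => [|_ [a /eig[->|->] <-]]//; last first.
  by rewrite Normc.normc0 normc_ge0.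
exists (inner g f) => //=; apply/eigenvalueP; exists (f^t* ).
  by rewrite mulmxA [f^t* *m g]mx11_scalar mul_scalar_mx innerE.
by apply: contra_neq cn0 => f0; rewrite innerE f0 mul0mx mxE.
Qed.

Lemma operator_norm_rank1 g f :
  operator_norm (g *m f^t*) = l2norm g * l2norm f.
Proof.
have gfE x : (g *m f^t*) *m x = inner x f *: g.
  by rewrite -mulmxA [X in _ *m X]mx11_scalar mul_mx_scalar innerE.
have nf1 : f != 0 -> l2norm ((l2norm f)%:C^-1 *: f) = 1.
  move=> fn0; rewrite l2normZ Normc.normcV normc_real ger0_norm ?l2norm_ge0//.
  by rewrite mulVf// l2norm_eq0.
apply: sup_max => [|_ [x x1 <-]]; last first.
  rewrite gfE l2normZ mulrC ler_wpM2l ?l2norm_ge0//.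
  by rewrite (le_trans (inner_CauchySchwarz _ _))// ler_piMl ?l2norm_ge0.
(* The supremum is attained at [f / ||f||], or at [0] if [f = 0]. *)
have [->|fn0] := eqVneq f 0.
  by exists 0; rewrite /= ?mulmx0 !l2norm0 ?mulr0.
exists ((l2norm f)%:C^-1 *: f); first by rewrite /= nf1.
rewrite gfE l2normZ innerZl -sqr_l2norm rmorphXn expr2 mulKf; last first.
  by rewrite fmorph_eq0 l2norm_eq0.
by rewrite normc_real ger0_norm ?l2norm_ge0// mulrC.
Qed.
End Inner.

(** * Dual pairs and error operators *)

Lemma erasure_op_delta {R : realType} {N n : nat}
    (F G : 'I_N -> 'cV[R[i]]_n) i :
  erasure_op F G (delta_mx i i) = G i *m (F i)^t*.
Proof.
apply/matrixP=> k l; rewrite /erasure_op !mxE big_ord1 (bigD1 i)//= big1 ?addr0.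
  rewrite !mxE (bigD1 i)//= big1 ?addr0 => [|j /negPf neq_ji].
    by rewrite !mxE !eqxx mulr1 conjCK.
  by rewrite !mxE neq_ji mulr0.
move=> j /negPf neq_ji; rewrite !mxE big1 ?mul0r// => m _.
by rewrite !mxE neq_ji andbF mulr0.
Qed.

Lemma dual_pair_trace {R : realType} {N n : nat} {F G : 'I_N -> 'cV[R[i]]_n} :
  is_dual_pair F G -> \sum_i inner (G i) (F i) = n%:R.
Proof.
case=> _ _ rec.
have rec1 : \sum_i G i *m (F i)^t* = 1%:M.
  apply: mulmx_col_inj => f; rewrite mul1mx [RHS]rec mulmx_suml.
  apply: eq_bigr => i _.
  by rewrite -mulmxA [X in _ *m X]mx11_scalar mul_mx_scalar innerE.
rewrite -(mxtrace1 R[i] n) -rec1 raddf_sum/=; apply: eq_bigr => i _.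
by rewrite innerE mxtrace_mulC trace_mx11.
Qed.

(** * Power means *)

(** Proved by summing Young's inequality for [a i] and [m ^ (p - 1)], where [m]
    is the arithmetic mean. *)
Lemma power_mean {R : realType} {N : nat} {p : R} {a : 'I_N -> R} :
  1 < p -> (forall i, 0 <= a i) ->
  N%:R^-1 * \sum_i a i <= (N%:R^-1 * \sum_i a i `^ p) `^ p^-1.
Proof.
move=> p1 a0; have p0 : 0 < p := lt_trans ltr01 p1.
set m := N%:R^-1 * _; set s := N%:R^-1 * _.
have m0 : 0 <= m by rewrite mulr_ge0 ?invr_ge0 ?sumr_ge0.
have [->|mn0] := eqVneq m 0; first exact: powR_ge0.
have Nn0 : N%:R != 0 :> R.
  by apply: contra_neq mn0 => N0; rewrite /m N0 invr0 mul0r.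
suff ms : m `^ p <= s.
  rewrite -[m](powRr1 m0) -(mulfV (lt0r_neq0 p0)) powRrM.
  apply: ge0_ler_powR; rewrite ?invr_ge0 ?nnegrE ?powR_ge0 ?(ltW p0)//.
  exact: le_trans (powR_ge0 _ _) ms.
pose q := p / (p - 1).
have pm10 : p - 1 != 0 by rewrite subr_eq0 gt_eqF.
have q0 : 0 < q by rewrite divr_gt0 ?subr_gt0.
have pq : p^-1 + q^-1 = 1.
  by rewrite /q invf_div mulrBl divff ?gt_eqF// mul1r addrC subrK.
have young i : a i * m `^ (p - 1) <= a i `^ p / p + m `^ p / q.
  have -> : m `^ p = (m `^ (p - 1)) `^ q.
    by rewrite -powRrM /q mulrC divfK.
  by apply: conjugate_powR; rewrite ?powR_ge0.
have : N%:R^-1 * \sum_i (a i * m `^ (p - 1)) <=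
       N%:R^-1 * \sum_i (a i `^ p / p + m `^ p / q).
  by rewrite ler_wpM2l ?invr_ge0// ler_sum.
rewrite -mulr_suml mulrA -/m mulr_powRB1// big_split/=.
rewrite -mulr_suml sumr_const card_ord.
rewrite -[m `^ p / q *+ N]mulr_natl mulrDr (mulKf Nn0) mulrA -/s -lerBlDr.
by rewrite -[X in X - _]mulr1 -pq mulrDr addrK ler_pM2r ?invr_gt0//.
Qed.

(** For [N = 0] the mean is [0], whence the condition on [c]. *)
Lemma power_mean_cst {R : realType} {N : nat} {p c : R} :
  1 < p -> 0 <= c -> (N%:R = 0 :> R -> c = 0) ->
  (N%:R^-1 * \sum_(i < N) c `^ p) `^ p^-1 = c.
Proof.
move=> p1 c0 cN; have p0 : p != 0 by rewrite gt_eqF// (lt_trans ltr01).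
rewrite sumr_const card_ord -[c `^ p *+ N]mulr_natl mulrA.
have [N0|Nn0] := eqVneq (N%:R : R) 0.
  by rewrite N0 mulr0 mul0r powR0 ?invr_eq0// cN.
by rewrite mulVf// mul1r -powRrM mulfV// powRr1.
Qed.

(** * Optimality of uniform dual pairs *)

Section Optimality.
Context {R : realType} {N n : nat}.
Implicit Types F G : 'I_N -> 'cV[R[i]]_n.

Lemma E1E (p : R) F G :
  E1 p F G = (N%:R^-1 * \sum_i Normc.normc (inner (G i) (F i)) `^ p) `^ p^-1.
Proof.
rewrite /E1 sum_D1; congr ((_ * _) `^ _); apply: eq_bigr => i _.
by rewrite erasure_op_delta spectral_radius_rank1.
Qed.

Lemma O1E (p : R) F G :
  O1 p F G = (N%:R^-1 * \sum_i (l2norm (G i) * l2norm (F i)) `^ p) `^ p^-1.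
Proof.
rewrite /O1 sum_D1; congr ((_ * _) `^ _); apply: eq_bigr => i _.
by rewrite erasure_op_delta operator_norm_rank1.
Qed.

Lemma dual_pair_trace_le {F G} :
  is_dual_pair F G -> n%:R <= \sum_i Normc.normc (inner (G i) (F i)).
Proof.
move=> FG; rewrite -lecR rmorph_nat -[leLHS]normr_nat -(dual_pair_trace FG).
by rewrite (rmorph_sum (real_complex R)) (le_trans (ler_norm_sum _ _ _))//.
Qed.

(** The bound also holds for [N = 0], when [n / N] is [0] by the convention on
    inverses. *)
Lemma E1_ge {p : R} {F G} : 1 < p -> is_dual_pair F G ->
  n%:R / N%:R <= E1 p F G.
Proof.
move=> p1 FG; rewrite E1E (le_trans _ (power_mean p1 (fun i => normc_ge0 _)))//.
by rewrite mulrC ler_wpM2l ?invr_ge0// dual_pair_trace_le.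
Qed.

Lemma O1_ge {p : R} {F G} : 1 < p -> is_dual_pair F G ->
  n%:R / N%:R <= O1 p F G.
Proof.
move=> p1 FG; rewrite O1E.
have normFG_ge0 i : 0 <= l2norm (G i) * l2norm (F i).
  by rewrite mulr_ge0 ?l2norm_ge0.
rewrite (le_trans _ (power_mean p1 normFG_ge0))//.
rewrite mulrC ler_wpM2l ?invr_ge0// (le_trans (dual_pair_trace_le FG))//.
by apply: ler_sum => i _; exact: inner_CauchySchwarz.
Qed.

Lemma uniform_dual_pair_optimal (p : R) F G : 1 < p -> is_dual_pair F G ->
  (forall i, Normc.normc (inner (G i) (F i)) = n%:R / N%:R) ->
  (forall i, l2norm (G i) * l2norm (F i) = n%:R / N%:R) ->
  E1_optimal p (F, G) /\ O1_optimal p (F, G).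
Proof.
move=> p1 FG innerFG normFG.
have c0 : 0 <= n%:R / N%:R :> R by rewrite divr_ge0.
have cN : N%:R = 0 :> R -> n%:R / N%:R = 0 :> R.
  by move=> ->; rewrite invr0 mulr0.
have E1FG : E1 p F G = n%:R / N%:R.
  by rewrite E1E; under eq_bigr do rewrite innerFG; rewrite power_mean_cst.
have O1FG : O1 p F G = n%:R / N%:R.
  by rewrite O1E; under eq_bigr do rewrite normFG; rewrite power_mean_cst.
have dpFG : dual_pairs (F, G) by [].
have E1min FG' : @dual_pairs R N n FG' -> E1 p F G <= E1 p FG'.1 FG'.2.
  by move=> FG'_dual; rewrite E1FG; exact: E1_ge.
have O1min FG' : @dual_pairs R N n FG' -> O1 p F G <= O1 p FG'.1 FG'.2.
  by move=> FG'_dual; rewrite O1FG; exact: O1_ge.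
split; split=> //.
  exact: (inf_min (phi := fun FG : _ * ('I_N -> 'cV_n) => E1 p FG.1 FG.2)
                  dpFG E1min).
exact: (inf_min (phi := fun FG : _ * ('I_N -> 'cV_n) => O1 p FG.1 FG.2)
                  dpFG O1min).
Qed.

(** * Tight frames and their canonical duals *)

Lemma frame_opE F f : frame_op F *m f = \sum_i inner f (F i) *: F i.
Proof.
rewrite /frame_op -mulmxA analysis_adjE; apply: eq_bigr => i _.
by rewrite analysisE mxE.
Qed.

Lemma inner_frame_op F f :
  inner (frame_op F *m f) f = (\sum_i Normc.normc (inner f (F i)) ^+ 2)%:C.
Proof.
rewrite frame_opE innerE mulmx_sumr summxE rmorph_sum; apply: eq_bigr => i _.
by rewrite -innerE innerZl [inner (F i) f]innerC rmorphXn/= normc_normE normCK.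
Qed.

(** Polarization: the form vanishes at [x + y] and at [x + i y]. *)
Lemma quadratic_form_eq0 (M : 'M[R[i]]_n) :
  (forall f, inner (M *m f) f = 0) -> M = 0.
Proof.
move=> M0.
have Mxy0 x y : inner (M *m x) y = 0.
  have := M0 (x + y); have := M0 (x + 'i%R *: y).
  rewrite !mulmxDr -!scalemxAr !innerDl !innerDr !innerZl !innerZr !M0 conjCi.
  rewrite !mulr0 !addr0 !add0r mulNr addrC => /eqP.
  rewrite subr_eq0 => /eqP /(mulfI (neq0Ci _)) ->.
  by move/eqP; rewrite -mulr2n mulrn_eq0/= => /eqP.
apply: mulmx_col_inj => x; rewrite mul0mx; apply/eqP.
rewrite -l2norm_eq0 -(sqrf_eq0 (l2norm _)) -(inj_eq (@complexI R)) sqr_l2norm.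
by rewrite Mxy0.
Qed.

Lemma tight_frame_op {F} {A : R} : frame_bounds F A A -> frame_op F = A%:C%:M.
Proof.
case=> _ _ bA; apply/eqP; rewrite -subr_eq0; apply/eqP/quadratic_form_eq0 => f.
rewrite mulmxBl mul_scalar_mx -scaleNr innerDl innerZl inner_frame_op.
by rewrite -sqr_l2norm -(le_anti (bA f)) mulNr rmorphM/= subrr.
Qed.

Lemma tight_canonical_dual {F} {A : R} : frame_bounds F A A ->
  canonical_dual F = fun i => A^-1%:C *: F i.
Proof.
move=> FA; apply/funext => i; rewrite /canonical_dual (tight_frame_op FA).
by rewrite invmx_scalar mul_scalar_mx fmorphV.
Qed.

Lemma tight_canonical_dual_pair {F} :
  is_tight_frame F -> is_dual_pair F (canonical_dual F).
Proof.
move=> [A FA]; have [A0 _ bA] := FA; split; first by exists A, A.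
  exists (A^-1), (A^-1); split; rewrite ?invr_gt0// => f.
  have sumE := le_anti (bA f).
  under eq_bigr do
    rewrite (tight_canonical_dual FA) innerZr Normc.normcM exprMn.
  rewrite -mulr_sumr -sumE normc_conj normc_real.
  rewrite ger0_norm ?invr_ge0 ?(ltW A0)//.
  by rewrite [A^-1 ^+ 2]expr2 -[_ * _ * (A * _)]mulrA mulKf ?lexx// lt0r_neq0.
move=> f.
have An0 : A%:C != 0 :> R[i] by rewrite fmorph_eq0 gt_eqF.
rewrite (tight_canonical_dual FA).
under eq_bigr do rewrite scalerA mulrC -scalerA.
rewrite -scaler_sumr -frame_opE (tight_frame_op FA) mul_scalar_mx scalerA.
by rewrite fmorphV mulVf// scale1r.
Qed.

(** * Tight frames of graphs *)

(** The diagonal of the identity [L ^ 2 = A L] for the Laplacian [L]: its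
    off-diagonal entries are [0] or [-1], so row [i] has squared length
    [d_i ^ 2 + d_i]. *)
Lemma tight_graph_sqnorm {e : rel 'I_N} {F} {A : R} :
  is_simple_graph e -> no_null_vertex e ->
  gramian F = laplacian R[i] e -> frame_bounds F A A ->
  forall i, inner (F i) (F i) = (A - 1)%:C.
Proof.
move=> [e_sym e_irr] dn0 FL FA i.
rewrite -gramianE.
have LL : laplacian R[i] e *m laplacian R[i] e = A%:C *: laplacian R[i] e.
  rewrite -FL /gramian mulmxA -[_ *m _ *m analysis F]mulmxA -/(frame_op F).
  by rewrite (tight_frame_op FA) mul_mx_scalar scalemxAl.
have Lii : laplacian R[i] e i i = (degree e i)%:R.
  by rewrite !mxE eqxx e_irr subr0.
have dC : (degree e i)%:R != 0 :> R[i] by rewrite pnatr_eq0; apply/eqP/dn0.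
have : (degree e i)%:R * ((degree e i)%:R + 1) = A%:C * (degree e i)%:R :> R[i].
  have /matrixP/(_ i i) := LL; rewrite [in RHS]mxE Lii => <-.
  rewrite mxE (bigD1 i)//= Lii mulrDr mulr1; congr (_ + _).
  rewrite /degree -sum1_card natr_sum big_mkcond [RHS]big_mkcond.
  apply: eq_bigr => j _.
  rewrite !mxE inE; have [->|neq_ji] := eqVneq j i; first by rewrite e_irr.
  rewrite [e j i]e_sym /=; case: (e i j); rewrite ?subr0 ?mulr0// !sub0r.
  by rewrite mulrNN mulr1.
rewrite FL Lii mulrC => /(mulIf dC) dA.
by rewrite rmorphB/= -dA rmorph1 addrK.
Qed.
End Optimality.

Theorem theorem5p5 (R : realType) (N n : nat) (p : R) (hp : 1 < p)
    (e : rel 'I_N) (he : is_simple_graph e) (hdeg : no_null_vertex e)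
    (F : 'I_N -> 'cV[R[i]]_n) (hF : is_graph_frame e F)
    (htight : is_tight_frame F) :
  E1_optimal p (F, canonical_dual F) /\ O1_optimal p (F, canonical_dual F).
Proof.
have [A FA] := htight; have [A0 _ _] := FA.
have dualF := tight_canonical_dual_pair htight.
have sqF := tight_graph_sqnorm he hdeg (proj2 hF) FA.
have GE i : canonical_dual F i = A^-1%:C *: F i.
  by rewrite (tight_canonical_dual FA).
have innerFG i : inner (canonical_dual F i) (F i) = (n%:R / N%:R : R)%:C.
  have N0 : N%:R != 0 :> R by rewrite pnatr_eq0 -lt0n (leq_trans _ (ltn_ord i)).
  have cE j : inner (canonical_dual F j) (F j) = (A^-1 * (A - 1))%:C.
    by rewrite GE innerZl sqF -rmorphM.
  have := dual_pair_trace dualF; under eq_bigr do rewrite cE.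
  rewrite sumr_const card_ord -rmorphMn -(rmorph_nat (real_complex R)).
  move=> /complexI.
  by rewrite cE -mulr_natr => <-; rewrite mulfK.
have c0 : 0 <= n%:R / N%:R :> R by rewrite divr_ge0.
apply: uniform_dual_pair_optimal => // i.
  by rewrite innerFG normc_real ger0_norm.
apply: complexI; rewrite -(innerFG i) GE l2normZ innerZl -sqr_l2norm.
by rewrite normc_real ger0_norm ?invr_ge0 ?(ltW A0)// -mulrA rmorphM.
Qed.
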